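(* If a discrete Hecke pair $(G,H)$ has property (T), then it is relatively unimodular.
   Context: A discrete Hecke pair $(G,H)$ consists of a locally compact group $G$ and an open subgroup $H$ such that every double coset $HxH$ ($x\in G$) is a union of finitely many left cosets of $H$ in $G$. As usual for discrete Hecke pairs, the topology of $G$ is ignored ($G$ is regarded as discrete). For $x\in G$ let $L(x)=|HxH/H|$ be the number of left cosets of $H$ in $HxH$, let $R(x)=|H\backslash HxH|$ be the number of right cosets of $H$ in $HxH$, and let $\Delta_{(G,H)}(x)=L(x)/R(x)$. The pair is relatively unimodular if $\Delta_{(G,H)}(x)=1$ for all $x\in G$. The pair $(G,H)$ has property (T) if every unitary representation $\pi$ of $G$ that has almost invariant $H$-fixed vectors (i.e. for every finite subset $Q\subseteq G$ and every $\varepsilon>0$ there is an $H$-fixed unit vector $\xi$ with $\sup_{x\in Q}\|\pi(x)\xi-\xi\|<\varepsilon$) has a nonzero $G$-invariant vector. *)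

(* Defs.v *)
From HB Require Import structures.
From mathcomp Require Import all_boot all_order all_algebra.
From mathcomp Require Import finmap.
From mathcomp Require Import all_classical all_reals all_analysis.
From mathcomp Require Import complex.

Set Implicit Arguments.
Unset Strict Implicit.
Unset Printing Implicit Defensive.

Import Order.TTheory GRing.Theory Num.Theory.
Import numFieldNormedType.Exports.

Local Open Scope classical_set_scope.
Local Open Scope complex_scope.
Local Open Scope ring_scope.

Section HeckePair.
Variables (G : groupType) (H : groupClosed G).

Definition left_coset (x : G) : set G := [set (x * h)%g | h in [set` H]].

Definition right_coset (x : G) : set G := [set (h * x)%g | h in [set` H]].

Definition double_coset (x : G) : set G :=
  [set (h * x * k)%g | h in [set` H] & k in [set` H]].

(* The topology of G plays no role: G is an abstract (discrete) group. *)
Definition hecke_pair : Prop :=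
  forall x : G, exists F : set (set G),
    [/\ finite_set F,
        F `<=` range left_coset
      & double_coset x = \bigcup_(C in F) C].

Definition left_cosets_in (A : set G) : set (set G) :=
  [set C | range left_coset C /\ C `<=` A].

Definition right_cosets_in (A : set G) : set (set G) :=
  [set C | range right_coset C /\ C `<=` A].

(* fset_set sends infinite sets to fset0, so L and R are only meaningful when
   (G, H) is a Hecke pair. *)
Definition hecke_L (x : G) : nat :=
  #|` fset_set (left_cosets_in (double_coset x))|%fset.

Definition hecke_R (x : G) : nat :=
  #|` fset_set (right_cosets_in (double_coset x))|%fset.

Definition relative_modular (x : G) : rat := (hecke_L x)%:R / (hecke_R x)%:R.

Definition relatively_unimodular : Prop :=
  forall x : G, relative_modular x = 1.

End HeckePair.

(* The inner product is linear in its first argument. *)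
Record hilbertType (R : realType) := Hilbert {
  hilbert_sort :> completeNormedModType R[i];
  inner : {dot hilbert_sort for (@Num.conj R[i])};
  inner_norm : forall u : hilbert_sort, `|u| ^+ 2 = inner u u
}.

(* Surjectivity of each operator follows from the group laws. *)
Record unitary_rep (R : realType) (G : groupType) (V : hilbertType R) :=
  UnitaryRep {
    rep_fun :> G -> {linear V -> V};
    rep_fun1 : forall v : V, rep_fun 1%g v = v;
    rep_funM : forall (x y : G) (v : V),
      rep_fun (x * y)%g v = rep_fun x (rep_fun y v);
    rep_fun_inner : forall (x : G) (u v : V),
      inner V (rep_fun x u) (rep_fun x v) = inner V u v
  }.

Section PropertyT.
Variables (R : realType) (G : groupType).

Definition fixed_vector (V : hilbertType R) (pi : unitary_rep G V)
    (A : set G) (v : V) : Prop :=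
  forall x : G, A x -> pi x v = v.

(* The norm of V is valued in R[i], hence the real part; sup set0 = 0. *)
Definition almost_invariant_fixed_vectors (H : groupClosed G)
    (V : hilbertType R) (pi : unitary_rep G V) : Prop :=
  forall (Q : set G) (e : R), finite_set Q -> 0 < e ->
    exists xi : V,
      [/\ fixed_vector pi [set` H] xi,
          `|xi| = 1
        & sup [set complex.Re `|pi x xi - xi| | x in Q] < e].

Definition property_T (H : groupClosed G) : Prop :=
  forall (V : hilbertType R) (pi : unitary_rep G V),
    almost_invariant_fixed_vectors H pi ->
    exists2 v : V, v != 0 & fixed_vector pi setT v.

End PropertyT.

(* Main.v *)
From HB Require Import structures.
From mathcomp Require Import all_boot all_order all_algebra finmap.
From mathcomp Require Import all_classical all_reals all_analysis.
From mathcomp Require Import complex ring lra.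
Require Import Defs.

(** The function [L(x) / R(x)] is a group homomorphism to the positive rationals
    and is trivial on [H]; property (T) leaves no room for a nontrivial one.

    Multiplicativity is a count of suborbits in the action of [G] on [G/H]. The
    number [L(x)] is the size of the orbit of the coset [xH] under the stabiliser
    [H] of the base point, and [R(x) = L(x^-1)] since inversion exchanges left and
    right cosets. For points [a], [b] of a [G]-set let [n(a, b)] be the size of the
    orbit of [b] under the stabiliser of [a]. The orbit of a pair [(b, c)] under
    the stabiliser of [a] can be fibred over [b] or over [c]; comparing the two
    counts at each vertex of the triangle [a, b, c] yields
    [n(a,b) n(b,c) n(c,a) = n(b,a) n(c,b) n(a,c)] ([subdegree_cocycle]), which at
    the cosets of [1], [x] and [xy] says that [L(x) / L(x^-1)] is multiplicative
    ([hecke_L_cocycle]).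

    On the side of property (T), let [lam] be a homomorphism from [G] to the
    additive reals that vanishes on [H], and suppose that [lam x0 = 1]. On the
    Hilbert space of square-summable complex sequences let [x] multiply the
    [n]-th coordinate by [exp (i lam(x) / (n + 1))]. The basis vectors are
    [H]-fixed and almost invariant, because the characters tend to 1 pointwise. A
    vector fixed by [x0] vanishes, because [exp (i / (n + 1))] is never 1. Property
    (T) excludes this, so every such homomorphism is zero
    ([property_T_hom_real]); the theorem applies it to the logarithm of
    [L(x) / L(x^-1)]. The Hilbert space is constructed below, completeness
    included ([ell2_complete]). *)

Set Implicit Arguments.
Unset Strict Implicit.
Unset Printing Implicit Defensive.
Import Order.TTheory GRing.Theory Num.Theory.
Import numFieldNormedType.Exports.
Local Open Scope classical_set_scope.
Local Open Scope complex_scope.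
Local Open Scope ring_scope.

(** * Suborbits of a group action *)

Section SetCard.

Definition scard (T : choiceType) (A : set T) : nat := #|` fset_set A|%fset.

Lemma scard_gt0 (T : choiceType) (A : set T) x :
  finite_set A -> A x -> (0 < scard A)%N.
Proof.
move=> fA Ax; rewrite /scard cardfs_gt0; apply/fset0Pn.
by exists x; rewrite in_fset_set// inE.
Qed.

Lemma scard_image (T U : choiceType) (f : T -> U) (A : set T) :
  finite_set A -> {in A &, injective f} -> scard (f @` A) = scard A.
Proof.
move=> fA finj; rewrite /scard fset_set_image// card_in_imfset//= => x y.
rewrite !in_fset_set//; exact: finj.
Qed.

Lemma scardX (T U : choiceType) (A : set T) (B : set U) :
  finite_set A -> finite_set B -> scard (A `*` B) = (scard A * scard B)%N.
Proof.
move=> fA fB; rewrite /scard fset_setX// !card_fset_sum1 big_distrl/=.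
under [RHS]eq_bigr do rewrite mul1n.
rewrite pair_big_dep_cond/=; congr (bigop _ (enum_fset _) _).
by apply/fsetP => -[x y]; rewrite !inE/= !andbT.
Qed.

End SetCard.

Section Suborbits.
Variables (G : groupType) (T : choiceType) (act : G -> T -> T).
Hypothesis act1 : forall t, act 1%g t = t.
Hypothesis actM : forall x y t, act (x * y)%g t = act x (act y t).

Definition stab (a : T) : set G := [set g | act g a = a].

Definition suborbit (K : set G) (b : T) : set T := [set act g b | g in K].

Definition suborbit2 (K : set G) (b c : T) : set (T * T) :=
  [set (act g b, act g c) | g in K].

Definition closedMV (K : set G) : Prop :=
  (forall x y, K x -> K y -> K (x * y)%g) /\ (forall x, K x -> K x^-1%g).

Lemma actK g t : act g^-1%g (act g t) = t.
Proof. by rewrite -actM mulVg act1. Qed.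

Lemma act_inj g : injective (act g).
Proof. exact: can_inj (actK g). Qed.

Lemma stab_closedMV a : closedMV (stab a).
Proof.
split=> [x y xa ya|x xa]; first by rewrite /stab /= actM ya xa.
by rewrite /stab /= -[in LHS]xa actK.
Qed.

(** The orbit of a pair fibres over the orbit of its first entry: translating
    by an element of [K] that carries [b] to a given point identifies the fibre
    over that point with the orbit of [c] under the stabiliser of [b] in [K]. *)
Lemma scard_suborbit2 (K : set G) b c : closedMV K ->
  finite_set (suborbit K b) -> finite_set (suborbit K c) ->
  scard (suborbit2 K b c) =
  (scard (suborbit K b) * scard (suborbit (K `&` stab b) c))%N.
Proof.
move=> [KM KV] fb fc.
have fcb : finite_set (suborbit (K `&` stab b) c).
  by apply: sub_finite_set fc => _ [g [Kg _] <-]; exists g.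
(* A transversal: [r p] carries [b] to [p]. *)
have /choice[r rP] (p : T) :
    exists g, suborbit K b p -> K g /\ act g b = p.
  have [[g Kg gb]|np] := pselect (suborbit K b p); first by exists g.
  by exists 1%g.
rewrite -scardX//.
have -> : suborbit2 K b c = (fun p => (p.1, act (r p.1) p.2)) @`
    (suborbit K b `*` suborbit (K `&` stab b) c).
  apply/seteqP; split=> [_ [g Kg <-]|_ [[p q] [/= pb [h [Kh hb] <-]] <-]].
    have gb : suborbit K b (act g b) by exists g.
    have [Kr rb] := rP _ gb.
    exists (act g b, act ((r (act g b))^-1 * g)%g c) => /=.
      split=> //=; exists ((r (act g b))^-1 * g)%g => //; split.
        by apply: KM => //; exact: KV.
      by rewrite /stab /= actM -[in X in act _ X]rb actK.
    by rewrite actM -[X in (_, X)]actM mulgV act1.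
  have [Kr rb] := rP _ pb.
  by exists (r p * h)%g; [exact: KM | rewrite !actM hb rb].
apply: scard_image; first exact: finite_setX.
by move=> [p q] [p' q'] _ _ /= [<- /act_inj ->].
Qed.

Definition subdegree a b : nat := scard (suborbit (stab a) b).

Lemma suborbit_act g a b :
  suborbit (stab (act g a)) (act g b) = act g @` suborbit (stab a) b.
Proof.
apply/seteqP; split=> [_ [h ha <-]|_ [_ [h ha <-] <-]].
  exists (act (g^-1 * h * g)%g b); last by rewrite -!actM !mulgA mulgV mul1g.
  by exists (g^-1 * h * g)%g => //; rewrite /stab /= !actM ha actK.
exists (g * h * g^-1)%g; last by rewrite !actM actK.
by rewrite /stab /= !actM actK ha.
Qed.

(* Suborbits are finite only between the points of [D]; for a Hecke pair these
   are the left cosets among all subsets of the group. *)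
Variable D : set T.
Hypothesis fin : forall a b, D a -> D b -> finite_set (suborbit (stab a) b).

Lemma subdegree_act g a b : D a -> D b ->
  subdegree (act g a) (act g b) = subdegree a b.
Proof.
move=> Da Db; rewrite /subdegree suborbit_act scard_image//; first exact: fin.
by move=> x y _ _; exact: act_inj.
Qed.

Lemma subdegree_gt0 a b : D a -> D b -> (0 < subdegree a b)%N.
Proof.
move=> Da Db; apply: (@scard_gt0 _ _ b); first exact: fin.
by exists 1%g; exact: act1.
Qed.

Lemma scard_suborbit2C K b c : finite_set (suborbit2 K b c) ->
  scard (suborbit2 K c b) = scard (suborbit2 K b c).
Proof.
move=> f2; rewrite -(@scard_image _ _ (fun p => (p.2, p.1)) (suborbit2 K b c))//.
  congr scard; apply/seteqP; split=> [_ [g Kg <-]|_ [_ [g Kg <-] <-]].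
    by exists (act g b, act g c) => //; exists g.
  by exists g.
by move=> [x y] [x' y'] _ _ /= [-> ->].
Qed.

(** Both sides count the orbit of the pair [(b, c)] under the stabiliser of [a],
    fibred over [b] on the left and over [c] on the right. *)
Lemma subdegree_exchange a b c : D a -> D b -> D c ->
  (subdegree a b * scard (suborbit (stab a `&` stab b) c) =
   subdegree a c * scard (suborbit (stab a `&` stab c) b))%N.
Proof.
move=> Da Db Dc.
rewrite /subdegree -!scard_suborbit2; do ?[exact: stab_closedMV | exact: fin].
apply: scard_suborbit2C.
apply: sub_finite_set (finite_setX (fin Da Dc) (fin Da Db)).
by move=> _ [g ga <-]; split; exists g.
Qed.

(** This is the cocycle identity for [subdegree a b / subdegree b a]. Writing
    [Sa], [Sb], [Sc] for the size of the orbit of one of the three points under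
    the common stabiliser of the other two, the exchange lemma applied at each
    of the three points gives three equations; in their product [Sa * Sb * Sc]
    occurs on both sides and cancels. *)
Lemma subdegree_cocycle a b c : D a -> D b -> D c ->
  (subdegree a b * subdegree b c * subdegree c a =
   subdegree b a * subdegree c b * subdegree a c)%N.
Proof.
move=> Da Db Dc.
have := subdegree_exchange Da Db Dc; have := subdegree_exchange Db Dc Da.
have := subdegree_exchange Dc Da Db.
rewrite (setIC (stab c) (stab a)) (setIC (stab c) (stab b)).
rewrite (setIC (stab b) (stab a)).
have S_gt0 x y z : D x -> D z -> (0 < scard (suborbit (stab x `&` stab y) z))%N.
  move=> Dx Dz; apply: (@scard_gt0 _ _ z); first last.
    by exists 1%g; [split; exact: act1|exact: act1].
  by apply: sub_finite_set (fin Dx Dz) => _ [g [gx _] <-]; exists g.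
have := S_gt0 a b c Da Dc; have := S_gt0 a c b Da Db; have := S_gt0 b c a Db Da.
set Sa := scard _; set Sb := scard _; set Sc := scard _.
move=> Sa0 Sb0 Sc0 Eca Ebc Eab.
apply/eqP; rewrite -(@eqn_pmul2r (Sa * Sb * Sc)%N) ?muln_gt0 ?Sa0 ?Sb0//.
apply/eqP.
transitivity ((subdegree a b * Sc) * (subdegree b c * Sa) * (subdegree c a * Sb))%N.
  by ring.
by rewrite Eab Ebc Eca; ring.
Qed.

End Suborbits.

(** * Left cosets and the relative modular function *)

Section Hecke.
Variables (G : groupType) (H : groupClosed G).

Definition translate (g : G) (A : set G) : set G := [set (g * x)%g | x in A].

Lemma translate1 A : translate 1%g A = A.
Proof.
apply/seteqP; split=> [_ [x Ax <-]|x Ax]; first by rewrite mul1g.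
by exists x => //; rewrite mul1g.
Qed.

Lemma translateM x y A : translate (x * y)%g A = translate x (translate y A).
Proof.
apply/seteqP; split=> [_ [z Az <-]|_ [_ [z Az <-] <-]].
  by exists (y * z)%g; [exists z|rewrite mulgA].
by exists z => //; rewrite mulgA.
Qed.

Lemma left_cosetM x y : left_coset H (x * y)%g = translate x (left_coset H y).
Proof. exact: translateM. Qed.

Lemma left_coset_refl x : left_coset H x x.
Proof. by exists 1%g; [exact: gpred1 | rewrite mulg1]. Qed.

Lemma left_coset_eq x y : left_coset H x y -> left_coset H y = left_coset H x.
Proof.
move=> [h /= Hh <-]; apply/seteqP; split=> [_ [k /= Hk <-]|_ [k /= Hk <-]].
  by exists (h * k)%g; [exact: gpredM|rewrite mulgA].
by exists (h^-1 * k)%g; [rewrite /= gpredM ?gpredV|rewrite mulgA mulgK].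
Qed.

Lemma stab_left_coset x : stab translate (left_coset H x) =
  [set (x * h * x^-1)%g | h in [set` H]].
Proof.
apply/seteqP; split=> [g gx|_ [h /= Hh <-]]; last first.
  rewrite /stab /= -left_cosetM mulgVK.
  by apply: left_coset_eq; exists h.
have : left_coset H x (g * x)%g.
  by rewrite -[X in X _]gx -left_cosetM; exact: left_coset_refl.
by move=> [h /= Hh hE]; exists h => //; rewrite hE mulgK.
Qed.

(** The stabiliser of the base point [H] of [G/H] is [H] itself, and the orbit of
    [xH] under it consists of the left cosets that make up [HxH]. *)
Lemma left_cosets_in_double x :
  left_cosets_in H (double_coset H x) =
  suborbit translate (stab translate (left_coset H 1%g)) (left_coset H x).
Proof.
apply/seteqP; split=> [C [[y _ <-] yx]|_ [g + <-]].
  have [h /= Hh [k /= Hk yE]] := yx _ (left_coset_refl y).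
  exists h; first by rewrite stab_left_coset; exists h => //; rewrite mul1g invg1 mulg1.
  by rewrite -left_cosetM; apply/esym/left_coset_eq; exists k.
rewrite stab_left_coset => -[h /= Hh <-]; rewrite mul1g invg1 mulg1 -left_cosetM.
split; first by exists (h * x)%g.
by move=> _ [k /= Hk <-]; exists h => //; exists k.
Qed.

Lemma hecke_L_subdegree x :
  hecke_L H x = subdegree translate (left_coset H 1%g) (left_coset H x).
Proof. by rewrite /hecke_L left_cosets_in_double. Qed.

Hypothesis hp : hecke_pair H.

Lemma finite_left_cosets_in x : finite_set (left_cosets_in H (double_coset H x)).
Proof.
have [F [fF Flc xE]] := hp x; apply: sub_finite_set fF => C [[y _ <-] yx].
have := yx _ (left_coset_refl y); rewrite xE => -[D FD Dy].
have [z _ zD] := Flc _ FD.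
by rewrite (@left_coset_eq z) ?zD.
Qed.

Lemma finite_suborbit_left_coset a b :
  range (left_coset H) a -> range (left_coset H) b ->
  finite_set (suborbit translate (stab translate a) b).
Proof.
move=> [x _ <-] [y _ <-].
have -> : left_coset H x = translate x (left_coset H 1%g).
  by rewrite -left_cosetM mulg1.
have -> : left_coset H y = translate x (left_coset H (x^-1 * y)%g).
  by rewrite -left_cosetM mulgA mulgV mul1g.
rewrite suborbit_act; [|exact: translate1|exact: translateM].
by apply: finite_image; rewrite -left_cosets_in_double; exact: finite_left_cosets_in.
Qed.

Lemma subdegree_left_coset x y :
  subdegree translate (left_coset H x) (left_coset H y) = hecke_L H (x^-1 * y)%g.
Proof.
rewrite hecke_L_subdegree.
have rlc z : range (left_coset H) (left_coset H z) by exists z.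
rewrite -[RHS](subdegree_act translate1 translateM finite_suborbit_left_coset x)//.
by rewrite -!left_cosetM mulg1 mulgA mulgV mul1g.
Qed.

(** The cocycle identity at the cosets of [1], [x] and [x * y]: it says that
    [L(x) / L(x^-1)] is multiplicative in [x]. *)
Lemma hecke_L_cocycle x y :
  (hecke_L H x * hecke_L H y * hecke_L H (x * y)^-1%g =
   hecke_L H x^-1%g * hecke_L H y^-1%g * hecke_L H (x * y)%g)%N.
Proof.
have rlc z : range (left_coset H) (left_coset H z) by exists z.
have := subdegree_cocycle translate1 translateM finite_suborbit_left_coset
  (rlc 1%g) (rlc x) (rlc (x * y)%g).
by rewrite !subdegree_left_coset invg1 !mul1g !mulg1 invgM mulgVK mulgA mulVg mul1g.
Qed.

Lemma hecke_L_gt0 x : (0 < hecke_L H x)%N.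
Proof.
have rlc z : range (left_coset H) (left_coset H z) by exists z.
rewrite hecke_L_subdegree.
by apply: (subdegree_gt0 translate1 finite_suborbit_left_coset).
Qed.

Lemma right_cosets_in_double x :
  right_cosets_in H (double_coset H x) =
  (fun C : set G => [set y^-1%g | y in C]) @`
    left_cosets_in H (double_coset H x^-1%g).
Proof.
have lcV y : [set z^-1%g | z in left_coset H y] = right_coset H y^-1%g.
  apply/seteqP; split=> [_ [_ [h /= Hh <-] <-]|_ [h /= Hh <-]].
    by exists h^-1%g; rewrite /= ?gpredV// invgM.
  exists (y * h^-1)%g; last by rewrite invgM invgK.
  by exists h^-1%g; rewrite /= ?gpredV.
have dcV y z : double_coset H y z -> double_coset H y^-1%g z^-1%g.
  move=> [h /= Hh [k /= Hk <-]]; exists k^-1%g; rewrite /= ?gpredV//.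
  by exists h^-1%g; rewrite /= ?gpredV// !invgM mulgA.
apply/seteqP; split=> [_ [[y _ <-] yx]|_ [_ [[y _ <-] yx] <-]].
  exists (left_coset H y^-1%g); last by rewrite lcV invgK.
  split; first by exists y^-1%g.
  move=> z yz; rewrite -[z]invgK; apply: dcV; apply: yx.
  by rewrite -[y]invgK -lcV; exists z.
split; first by exists y^-1%g.
by move=> _ [z /yx xz <-]; rewrite -[x]invgK; exact: dcV.
Qed.

(** Inversion exchanges left and right cosets and maps [HxH] to [Hx^-1H]. *)
Lemma hecke_R_LV x : hecke_R H x = hecke_L H x^-1%g.
Proof.
rewrite /hecke_R right_cosets_in_double.
apply: scard_image; first exact: finite_left_cosets_in.
suff VK : involutive (fun C : set G => [set y^-1%g | y in C]).
  by move=> A B _ _; exact: (inv_inj VK).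
move=> C; rewrite image_comp -[RHS]image_id; apply: eq_imagel => y _ /=.
exact: invgK.
Qed.

Lemma hecke_L_mem h : h \in H -> hecke_L H h = hecke_L H h^-1%g.
Proof.
move=> Hh; have -> : hecke_L H h = hecke_L H 1%g.
  by rewrite !hecke_L_subdegree; congr subdegree;
     apply: left_coset_eq; exists h; rewrite /= ?mul1g.
rewrite !hecke_L_subdegree; congr subdegree.
by apply/esym/left_coset_eq; exists h^-1%g; rewrite /= ?gpredV ?mul1g.
Qed.

End Hecke.

(** * Square-summable complex sequences *)

Section Csum.
Variable R : realType.
Local Notation C := R[i].
Implicit Types (f g : nat -> C) (u v : nat -> C) (a z w : C).

(* Real and imaginary parts are summed separately because the completeness and
   comparison theorems for series apply to real sequences. *)
Definition csummable f : Prop :=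
  cvgn (series (fun k => complex.Re (f k))) /\
  cvgn (series (fun k => complex.Im (f k))).

Definition csum f : C :=
  limn (series (fun k => complex.Re (f k))) +i*
  limn (series (fun k => complex.Im (f k))).

Lemma cvg_series_comb (x y : R) (f g h : nat -> R) :
  cvgn (series f) -> cvgn (series g) -> cvgn (series h) ->
  series (fun k => x * f k + y * g k + h k) @ \oo -->
    x * limn (series f) + y * limn (series g) + limn (series h).
Proof.
move=> cf cg ch.
have -> : series (fun k => x * f k + y * g k + h k) =
    (fun n => x * series f n + y * series g n + series h n).
  by apply/funext => n; rewrite /series /= !mulr_sumr -!big_split.
by apply: cvgD => //; apply: cvgD; apply: cvgMr.
Qed.

Lemma ReMD a z w : complex.Re (a * z + w) =
  complex.Re a * complex.Re z + (- complex.Im a) * complex.Im z + complex.Re w.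
Proof. by case: a z w => [? ?] [? ?] [? ?] /=; ring. Qed.

Lemma ImMD a z w : complex.Im (a * z + w) =
  complex.Im a * complex.Re z + complex.Re a * complex.Im z + complex.Im w.
Proof. by case: a z w => [? ?] [? ?] [? ?] /=; ring. Qed.

Lemma csum_cvg_lincomb a f g : csummable f -> csummable g ->
  series (fun k => complex.Re (a * f k + g k)) @ \oo -->
    complex.Re (a * csum f + csum g) /\
  series (fun k => complex.Im (a * f k + g k)) @ \oo -->
    complex.Im (a * csum f + csum g).
Proof.
move=> [rf jf] [rg jg]; rewrite ReMD ImMD; split.
- under eq_fun do rewrite ReMD.
  exact: cvg_series_comb.
- under eq_fun do rewrite ImMD.
  exact: cvg_series_comb.
Qed.

Lemma csummableP a f g : csummable f -> csummable g ->
  csummable (fun k => a * f k + g k).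
Proof. by move=> cf cg; have [/cvgP ? /cvgP] := csum_cvg_lincomb a cf cg. Qed.

Lemma csumP a f g : csummable f -> csummable g ->
  csum (fun k => a * f k + g k) = a * csum f + csum g.
Proof.
move=> cf cg; have [/cvg_lim rE /cvg_lim iE] := csum_cvg_lincomb a cf cg.
by rewrite {1}/csum rE// iE//; case: (a * _ + _).
Qed.

Lemma csum_conj f : csummable f -> csum (fun k => (f k)^*%C) = (csum f)^*%C.
Proof.
move=> [_ jf]; rewrite /csum /=; congr (_ +i* _).
  by congr (limn (series _)); apply/funext => k; case: (f k).
rewrite -lim_seriesN//; congr (limn (series _)); apply/funext => k.
by rewrite !fctE; case: (f k).
Qed.

Definition normsq z : R := complex.Re z ^+ 2 + complex.Im z ^+ 2.

Lemma normsq_ge0 z : 0 <= normsq z.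
Proof. by rewrite addr_ge0 ?sqr_ge0. Qed.

Lemma normsqM z w : normsq (z * w) = normsq z * normsq w.
Proof. by case: z w => [a b] [c d]; rewrite /normsq /=; ring. Qed.

Lemma normsq_eq0 z : normsq z = 0 -> z = 0.
Proof.
move=> /eqP; rewrite paddr_eq0 ?sqr_ge0// !sqrf_eq0 => /andP[/eqP zr /eqP zi].
by apply/eqP; rewrite eq_complex zr zi !eqxx.
Qed.

(** The difference of the two sides is [t * |z - w / t|^2]. *)
Lemma normsqD_le (t : R) z w : 0 < t ->
  normsq (z + w) <= (1 + t) * normsq z + (1 + t^-1) * normsq w.
Proof.
move=> t0; have tn0 : t != 0 by rewrite gt_eqF.
rewrite -subr_ge0.
have -> : (1 + t) * normsq z + (1 + t^-1) * normsq w - normsq (z + w) =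
    t * normsq (z - t^-1%:C * w).
  by case: z w => [a b] [c d]; rewrite /normsq /=; field.
by rewrite mulr_ge0 ?normsq_ge0// ltW.
Qed.

Definition sqsummable u : Prop := cvgn (series (fun k => normsq (u k))).

Definition norm2 u : R := limn (series (fun k => normsq (u k))).

(** All terms being nonnegative, bounding the partial sums is enough. *)
Lemma sqsummable_le (M : R) u :
  (forall n, \sum_(0 <= k < n) normsq (u k) <= M) -> sqsummable u.
Proof.
move=> uM; apply: nondecreasing_is_cvgn.
  by apply: nondecreasing_series => k _ _; exact: normsq_ge0.
by exists M => _ [n _ <-]; rewrite /series /=.
Qed.

Lemma norm2_le (M : R) u :
  (forall n, \sum_(0 <= k < n) normsq (u k) <= M) -> norm2 u <= M.
Proof.
move=> uM; apply: limr_le; first exact: (sqsummable_le uM).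
by apply: nearW => n; rewrite /series /=.
Qed.

Lemma norm2_ge u n : sqsummable u ->
  \sum_(0 <= k < n) normsq (u k) <= norm2 u.
Proof.
move=> cu; apply: (@nondecreasing_cvgn_le _ (series (fun k => normsq (u k)))) => //.
by apply: nondecreasing_series => k _ _; exact: normsq_ge0.
Qed.

Lemma normsq_le_norm2 u n : sqsummable u -> normsq (u n) <= norm2 u.
Proof.
move=> cu; apply: le_trans (norm2_ge n.+1 cu).
by rewrite big_nat_recr//= lerDr sumr_ge0// => k _; exact: normsq_ge0.
Qed.

Lemma norm2_ge0 u : sqsummable u -> 0 <= norm2 u.
Proof. by move=> cu; have := norm2_ge 0 cu; rewrite big_geq. Qed.

Lemma sqsummableD u v : sqsummable u -> sqsummable v ->
  sqsummable (fun k => u k + v k).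
Proof.
move=> cu cv; apply: (@sqsummable_le (2 * norm2 u + 2 * norm2 v)) => n.
apply: (@le_trans _ _ (2 * \sum_(0 <= k < n) normsq (u k) +
                       2 * \sum_(0 <= k < n) normsq (v k))).
  rewrite !mulr_sumr -big_split/=; apply: ler_sum => k _.
  by have := @normsqD_le 1 (u k) (v k) ltr01; rewrite invr1.
by rewrite lerD ?ler_pM2l ?norm2_ge.
Qed.

Lemma sum_normsqM z u n : \sum_(0 <= k < n) normsq (z * u k) =
  normsq z * \sum_(0 <= k < n) normsq (u k).
Proof. by rewrite mulr_sumr; apply: eq_bigr => k _; rewrite normsqM. Qed.

Lemma sqsummableZ z u : sqsummable u -> sqsummable (fun k => z * u k).
Proof.
move=> cu; apply: (@sqsummable_le (normsq z * norm2 u)) => n.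
by rewrite sum_normsqM ler_wpM2l ?normsq_ge0 ?norm2_ge.
Qed.

(** Each term is dominated by [|u_k|^2 + |v_k|^2]. *)
Lemma csummableM u v : sqsummable u -> sqsummable v ->
  csummable (fun k => u k * (v k)^*%C).
Proof.
move=> cu cv.
have c2 : cvgn (series ((fun k => normsq (u k)) + (fun k => normsq (v k)))).
  exact: is_cvg_seriesD.
have le_cvg (f : nat -> R) :
    (forall k, `|f k| <= normsq (u k) + normsq (v k)) -> cvgn (series f).
  move=> le_f; apply: normed_cvg; apply: series_le_cvg c2 => k //=.
  by rewrite addr_ge0 ?normsq_ge0.
have amgm (x y : R) : 2 * `|x * y| <= x ^+ 2 + y ^+ 2.
  rewrite -[x ^+ 2]real_normK ?num_real// -[y ^+ 2]real_normK ?num_real// normrM.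
  by rewrite -subr_ge0 [leRHS](_ : _ = (`|x| - `|y|) ^+ 2) ?sqr_ge0//; ring.
have sq0 (x : R) : 0 <= x ^+ 2 by exact: sqr_ge0.
split; apply: le_cvg => k; rewrite /normsq; case: (u k) (v k) => [a b] [c d] /=;
  rewrite (le_trans (ler_normD _ _))// ?normrN ?mulrN ?normrN.
  by have := (amgm a c); have := amgm b d; have := sq0 a; have := sq0 b;
    have := sq0 c; have := sq0 d; lra.
by have := (amgm a d); have := amgm b c; have := sq0 a; have := sq0 b;
  have := sq0 c; have := sq0 d; lra.
Qed.

Lemma csum_sqr u : sqsummable u ->
  csum (fun k => u k * (u k)^*%C) = (norm2 u)%:C.
Proof.
move=> cu; rewrite /csum /norm2; congr (_ +i* _).
  congr (limn (series _)); apply/funext => k; rewrite /normsq.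
  by case: (u k) => a b /=; ring.
rewrite [X in series X](_ : _ = fun=> 0); last first.
  by apply/funext => k; case: (u k) => a b /=; ring.
rewrite [series _](_ : _ = cst 0); first exact: lim_cst.
by apply/funext => n; rewrite /series /= big1.
Qed.

Lemma norm2Z z u : sqsummable u -> norm2 (fun k => z * u k) = normsq z * norm2 u.
Proof.
move=> cu; rewrite /norm2.
rewrite [X in series X](_ : _ = normsq z *: (fun k => normsq (u k))).
  exact: lim_seriesZ.
by apply/funext => k; rewrite normsqM.
Qed.

Lemma norm2D_le (t : R) u v : 0 < t -> sqsummable u -> sqsummable v ->
  norm2 (fun k => u k + v k) <= (1 + t) * norm2 u + (1 + t^-1) * norm2 v.
Proof.
move=> t0 cu cv; apply: norm2_le => n.
have t1 : 0 <= 1 + t^-1 by rewrite addr_ge0// invr_ge0 ltW.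
have t2 : 0 <= 1 + t by rewrite addr_ge0// ltW.
apply: (@le_trans _ _ ((1 + t) * \sum_(0 <= k < n) normsq (u k) +
                       (1 + t^-1) * \sum_(0 <= k < n) normsq (v k))).
  rewrite !mulr_sumr -big_split/=; apply: ler_sum => k _.
  exact: normsqD_le.
by rewrite lerD// ler_wpM2l// norm2_ge.
Qed.

Lemma norm2_eq0 u : sqsummable u -> norm2 u = 0 -> u = fun=> 0.
Proof.
move=> cu u0; apply/funext => k; apply: normsq_eq0; apply/le_anti.
by rewrite normsq_ge0 andbT -u0 normsq_le_norm2.
Qed.

(** Minkowski's inequality: in [norm2D_le] the right-hand side is minimal, and
    equal to the square of the sum of the norms, when [t] is the ratio of the
    norm of [v] to that of [u]. *)
Lemma sqrt_norm2D u v : sqsummable u -> sqsummable v ->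
  Num.sqrt (norm2 (fun k => u k + v k)) <=
  Num.sqrt (norm2 u) + Num.sqrt (norm2 v).
Proof.
move=> cu cv.
have [u0|/eqP u0] := eqVneq (norm2 u) 0.
  rewrite u0 sqrtr0 add0r (norm2_eq0 cu u0).
  by rewrite [X in norm2 X](_ : _ = v)//; apply/funext => k; rewrite add0r.
have [v0|/eqP v0] := eqVneq (norm2 v) 0.
  rewrite v0 sqrtr0 addr0 (norm2_eq0 cv v0).
  by rewrite [X in norm2 X](_ : _ = u)//; apply/funext => k; rewrite addr0.
have {}u0 : 0 < Num.sqrt (norm2 u).
  by rewrite sqrtr_gt0 lt_def norm2_ge0// andbT; apply/eqP.
have {}v0 : 0 < Num.sqrt (norm2 v).
  by rewrite sqrtr_gt0 lt_def norm2_ge0// andbT; apply/eqP.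
set r := Num.sqrt (norm2 u) in u0 *; set s := Num.sqrt (norm2 v) in v0 *.
have ru : norm2 u = r ^+ 2 by rewrite sqr_sqrtr ?norm2_ge0.
have sv : norm2 v = s ^+ 2 by rewrite sqr_sqrtr ?norm2_ge0.
have rs0 : 0 <= r + s by rewrite addr_ge0// ltW.
rewrite -[leRHS]ger0_norm// -sqrtr_sqr ler_wsqrtr//.
have := @norm2D_le (s / r) u v (divr_gt0 v0 u0) cu cv.
rewrite ru sv => /le_trans; apply.
have r0' : r != 0 by rewrite gt_eqF.
have s0' : s != 0 by rewrite gt_eqF.
rewrite [leLHS](_ : _ = (r + s) ^+ 2)//.
by field; rewrite r0' s0'.
Qed.

End Csum.

(** * The Hilbert space of square-summable sequences *)

Section Ell2.
Variable R : realType.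
Local Notation C := R[i].
Local Notation cseq := (nat -> C^o).

Definition sqsummable_pred : {pred cseq} := fun u => `[< sqsummable u >].

Lemma sqsummable_submod : submod_closed sqsummable_pred.
Proof.
split.
  apply/asboolP; apply: (@sqsummable_le _ 0) => n.
  by rewrite big1// => k _; rewrite /normsq /= expr0n addr0.
move=> a u v /asboolP cu /asboolP cv; apply/asboolP.
by apply: (@sqsummableD _ (fun k => a * u k) v) => //; exact: sqsummableZ.
Qed.

HB.instance Definition _ := GRing.isSubmodClosed.Build C cseq sqsummable_pred
  sqsummable_submod.

Record ell2 := Ell2 { ell2_val :> cseq; _ : ell2_val \in sqsummable_pred }.

HB.instance Definition _ := [isSub for ell2_val].
HB.instance Definition _ := [Choice of ell2 by <:].
HB.instance Definition _ := [SubChoice_isSubLmodule of ell2 by <:].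

Implicit Types u v w : ell2.

Lemma ell2P u : sqsummable u.
Proof. by apply/asboolP; exact: valP u. Qed.
Arguments ell2P : clear implicits.

Lemma ell2DE u v k : (u + v) k = u k + v k. Proof. by []. Qed.
Lemma ell2BE u v k : (u - v) k = u k - v k. Proof. by []. Qed.
Lemma ell2ZE (a : C) u k : (a *: u) k = a * u k. Proof. by []. Qed.

Definition ell2_norm u : C := (Num.sqrt (norm2 u))%:C.

Lemma ell2_normD u v : ell2_norm (u + v) <= ell2_norm u + ell2_norm v.
Proof.
rewrite /ell2_norm -[leRHS](rmorphD (real_complex R)) lecR.
exact: (sqrt_norm2D (ell2P u) (ell2P v)).
Qed.

Lemma ell2_normZ (a : C) u : ell2_norm (a *: u) = `|a| * ell2_norm u.
Proof.
rewrite /ell2_norm normc_def -[RHS](rmorphM (real_complex R)).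
rewrite [X in norm2 X](_ : _ = (fun k => a * u k))//.
by rewrite norm2Z; [rewrite sqrtrM ?normsq_ge0 | exact: ell2P].
Qed.

Lemma ell2_norm_eq0 u : ell2_norm u = 0 -> u = 0.
Proof.
move=> /(congr1 (@complex.Re R)) /= /eqP.
rewrite sqrtr_eq0 => u0; apply/val_inj; apply: norm2_eq0; first exact: ell2P.
by apply/le_anti; rewrite u0 norm2_ge0//; exact: ell2P.
Qed.

HB.instance Definition _ :=
  Lmodule_isNormed.Build C ell2 ell2_normD ell2_normZ ell2_norm_eq0.

Lemma ell2_normE u : `|u| = (Num.sqrt (norm2 u))%:C.
Proof. by []. Qed.

(** Bounding the norm by bounding every partial sum makes the closed balls stable
    under coordinatewise limits, which is how completeness uses it. *)
Lemma ell2_norm_leP u (e : R) : 0 <= e ->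
  (`|u| <= e%:C) <-> (forall n, \sum_(0 <= k < n) normsq (u k) <= e ^+ 2).
Proof.
move=> e0; rewrite ell2_normE lecR; split=> [ue n|ue].
  apply: (le_trans (norm2_ge n (ell2P u))).
  rewrite -[leLHS]sqr_sqrtr ?norm2_ge0//; last exact: ell2P.
  by rewrite ler_pXn2r ?nnegrE ?sqrtr_ge0.
rewrite -[leRHS]ger0_norm// -sqrtr_sqr ler_wsqrtr//.
exact: norm2_le.
Qed.

Lemma Re_coord_le u k : `|complex.Re (u k)|%:C <= `|u|.
Proof.
rewrite ell2_normE lecR -sqrtr_sqr ler_wsqrtr//.
apply: le_trans (normsq_le_norm2 k (ell2P u)).
by rewrite /normsq lerDl sqr_ge0.
Qed.

Lemma Im_coord_le u k : `|complex.Im (u k)|%:C <= `|u|.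
Proof.
rewrite ell2_normE lecR -sqrtr_sqr ler_wsqrtr//.
apply: le_trans (normsq_le_norm2 k (ell2P u)).
by rewrite /normsq lerDr sqr_ge0.
Qed.

Lemma gt0_complexP (e : C) : 0 < e -> exists2 r : R, 0 < r & e = r%:C.
Proof.
case: e => a b; rewrite ltcE /= => /andP[/eqP-> a0]; by exists a.
Qed.

(** A nonexpansive real function maps Cauchy filters to Cauchy filters; this is
    applied to the real and imaginary parts of each coordinate. *)
Lemma cauchy_cvg_1lipschitz (f : ell2 -> R) (F : set_system ell2) :
  (forall u v, `|f u - f v|%:C <= `|u - v|) ->
  ProperFilter F -> cauchy F -> exists l : R, f @ F --> l.
Proof.
move=> fl FF /cauchyP Fc; apply/cvg_ex/cauchy_cvgP/cauchy_exP => e e0.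
have [x Fx] := Fc e%:C (etrans (ltcR _ _) e0).
exists (f x); suff : F (f @^-1` ball (f x) e) by [].
apply: filterS Fx => y; rewrite -ball_normE /= => xy.
by rewrite -ball_normE /= -ltcR; exact: le_lt_trans (fl _ _) xy.
Qed.

(** The candidate limit [l] is the coordinatewise limit. If a ball of radius [e]
    around [x] belongs to the filter, then every partial sum of [|u - x|^2] is
    eventually at most [e^2]; passing to the limit in the finite sum gives the
    same bound for [l - x]. Hence [l] is square-summable and within [e] of [x],
    thus within [2e] of almost all [u]. *)
Lemma ell2_complete (F : set_system ell2) :
  ProperFilter F -> cauchy F -> cvg F.
Proof.
move=> FF Fc; have /cauchyP Fball := Fc.
have cRe k : exists l : R, (fun u : ell2 => complex.Re (u k)) @ F --> l.
  apply: cauchy_cvg_1lipschitz => // u v.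
  have := Re_coord_le (u - v) k; rewrite ell2BE.
  by case: (u k) (v k) => [? ?] [? ?].
have cIm k : exists l : R, (fun u : ell2 => complex.Im (u k)) @ F --> l.
  apply: cauchy_cvg_1lipschitz => // u v.
  have := Im_coord_le (u - v) k; rewrite ell2BE.
  by case: (u k) (v k) => [? ?] [? ?].
have /choice[a aF] := cRe; have /choice[b bF] := cIm.
pose l k : C := a k +i* b k.
have close (x : ell2) (e : R) : 0 < e -> F (ball x e%:C) ->
    forall n, \sum_(0 <= k < n) normsq (l k - x k) <= e ^+ 2.
  move=> e0 Fx n.
  have cvgS : (fun u : ell2 => \sum_(0 <= k < n) normsq (u k - x k)) @ F -->
      \sum_(0 <= k < n) normsq (l k - x k).
    elim: n => [|n IHn].
      by under eq_fun do rewrite big_geq//; rewrite big_geq//; exact: cvg_cst.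
    under eq_fun do rewrite big_nat_recr//=; rewrite big_nat_recr//=.
    apply: cvgD => //; set k := n.
    pose c := complex.Re (x k); pose d := complex.Im (x k).
    have nE (z : C) : normsq (z - x k) =
        (complex.Re z - c) ^+ 2 + (complex.Im z - d) ^+ 2.
      by rewrite /c /d; case: z (x k) => [? ?] [? ?].
    under eq_fun do rewrite nE.
    rewrite nE; rewrite !expr2; under eq_fun do rewrite !expr2.
    by apply: cvgD; apply: cvgM; apply: cvgB => //; exact: cvg_cst.
  apply: (cvgr_to_le cvgS).
  apply: filterS Fx => u; rewrite -ball_normE /= => xu.
  have := (@ell2_norm_leP (u - x) e (ltW e0)).1; apply.
  by rewrite ltW// distrC.
have [x1 Fx1] := Fball 1%:C (etrans (ltcR _ _) ltr01).
have ls : l \in sqsummable_pred.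
  apply/asboolP.
  have -> : l = (fun k => (l k - x1 k) + x1 k).
    by apply/funext => k; rewrite subrK.
  apply: sqsummableD; last exact: ell2P.
  exact: sqsummable_le (close x1 1 ltr01 Fx1).
apply/cvg_ex; exists (Ell2 ls).
apply/cvgrPdist_le => e /gt0_complexP[r r0 ->].
have r2 : 0 < r / 2 by rewrite divr_gt0.
have [x Fx] := Fball (r / 2)%:C (etrans (ltcR _ _) r2).
apply: filterS (Fx) => u; rewrite -ball_normE /= => xu.
rewrite -(subrKA x) (splitr r) (rmorphD (real_complex R)).
rewrite (le_trans (ler_normD _ _))// lerD//; last exact: ltW.
apply/ell2_norm_leP; first exact: ltW.
exact: close.
Qed.

HB.instance Definition _ := Uniform_isComplete.Build ell2 ell2_complete.

Definition ell2_inner u v : C := csum (fun k => u k * (v k)^*%C).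

Lemma ell2_innerC u v : ell2_inner u v = (ell2_inner v u)^*%C.
Proof.
rewrite /ell2_inner -csum_conj; last by apply: csummableM; exact: ell2P.
congr csum; apply/funext => k; apply/eqP; rewrite eq_complex.
by case: (u k) (v k) => [? ?] [? ?] /=; apply/andP; split; apply/eqP; ring.
Qed.

Lemma ell2_innerPl (a : C) u v w :
  ell2_inner (a *: u + v) w = a * ell2_inner u w + ell2_inner v w.
Proof.
rewrite /ell2_inner -csumP; [|by apply: csummableM; exact: ell2P..].
by congr csum; apply/funext => k; rewrite ell2DE ell2ZE mulrDl mulrA.
Qed.

Lemma ell2_inner_norm u : `|u| ^+ 2 = ell2_inner u u.
Proof.
rewrite /ell2_inner csum_sqr; last exact: ell2P.
rewrite ell2_normE -(rmorphXn (real_complex R)) sqr_sqrtr//.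
by apply: norm2_ge0; exact: ell2P.
Qed.

Lemma ell2_inner_bilinear :
  bilinear_for (GRing.Scale.Law.clone _ _ *%R _)
    (GRing.Scale.Law.clone _ _ (@Num.conj C \; *%R) _) ell2_inner.
Proof.
split=> [w a u v|w a u v] /=; first exact: ell2_innerPl.
rewrite ell2_innerC ell2_innerPl rmorphD rmorphM.
by rewrite (ell2_innerC w u) (ell2_innerC w v).
Qed.

HB.instance Definition _ := bilinear_isBilinear.Build C ell2 ell2 C
  _ _ ell2_inner ell2_inner_bilinear.

Lemma ell2_inner_hermitian u v :
  ell2_inner u v = (-1) ^+ false * Num.conj (ell2_inner v u).
Proof. by rewrite expr0 mul1r ell2_innerC. Qed.

HB.instance Definition _ := isHermitianSesquilinear.Build C ell2 false
  (@Num.conj C) ell2_inner ell2_inner_hermitian.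

Lemma ell2_inner_gt0 u : u != 0 -> 0 < ell2_inner u u.
Proof. by move=> u0; rewrite -ell2_inner_norm exprn_gt0 ?normr_gt0. Qed.

HB.instance Definition _ := isDotProduct.Build C ell2 ell2_inner ell2_inner_gt0.

Definition ell2_hilbert : hilbertType R :=
  @Hilbert R ell2 ell2_inner ell2_inner_norm.

End Ell2.
Arguments ell2P {R} u.

(** * Diagonal unitary operators *)

Section Rotation.
Variable R : realType.
Local Notation C := R[i].

Definition phase (t : R) : C := cos t +i* sin t.

Lemma phase0 : phase 0 = 1.
Proof. by rewrite /phase cos0 sin0. Qed.

Lemma phaseD s t : phase (s + t) = phase s * phase t.
Proof.
apply/eqP; rewrite eq_complex /= cosD sinD eqxx /=.
by apply/eqP; rewrite addrC.
Qed.

Lemma normsq_phase t : normsq (phase t) = 1.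
Proof. exact: cos2Dsin2. Qed.

(** Continuity of [t |-> e^{it}] at 0. *)
Lemma phase_near0 (e : R) : 0 < e ->
  exists2 d : R, 0 < d & forall t, `|t| < d -> normsq (phase t - 1) < e.
Proof.
move=> e0.
have nE t : normsq (phase t - 1) = 2 - 2 * cos t.
  have := cos2Dsin2 t; rewrite /normsq /phase /= oppr0 addr0 => cs.
  rewrite [LHS](_ : _ = (cos t ^+ 2 + sin t ^+ 2) + 1 - 2 * cos t); last by ring.
  by rewrite cs; ring.
have /cvgrPdist_lt /(_ _ (divr_gt0 e0 (ltr0n _ 2)))[d /= d0 cosd] := @continuous_cos R 0.
exists d => // t td; have := cosd t; rewrite /= sub0r normrN => /(_ td).
by rewrite cos0 nE ltr_norml => /andP[_]; lra.
Qed.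

Implicit Types (t : nat -> R) (u v : ell2 R).

Lemma rotation_subproof t u :
  (fun k => phase (t k) * u k : C^o) \in @sqsummable_pred R.
Proof.
apply/asboolP; have := ell2P u; rewrite /sqsummable.
by under [X in _ -> cvgn (series X)]eq_fun do rewrite normsqM normsq_phase mul1r.
Qed.

Definition rotation t u : ell2 R := Ell2 (rotation_subproof t u).

Lemma rotation_linear t : linear (rotation t).
Proof.
move=> a u v; apply/val_inj/funext => k.
by change (phase (t k) * (a * u k + v k) =
  a * (phase (t k) * u k) + phase (t k) * v k); ring.
Qed.

HB.instance Definition _ t :=
  GRing.isLinear.Build C (ell2 R) (ell2 R) _ (rotation t) (rotation_linear t).

Lemma rotation_inner t u v :
  ell2_inner (rotation t u) (rotation t v) = ell2_inner u v.
Proof.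
congr csum; apply/funext => k; rewrite /= rmorphM mulrACA.
rewrite [X in X * _](_ : _ = 1) ?mul1r//.
apply/eqP; rewrite eq_complex /= -(cos2Dsin2 (t k)).
by apply/andP; split; apply/eqP; ring.
Qed.

Definition single n (z : C) : nat -> C^o := fun k => if k == n then z else 0.

Lemma sum_normsq_single n z m :
  \sum_(0 <= k < m) normsq (single n z k) <= normsq z.
Proof.
rewrite (eq_bigr (fun k => if k == n then normsq z else 0)); last first.
  by move=> k _; rewrite /single; case: eqP => // _; rewrite /normsq /= expr0n addr0.
rewrite -big_mkcond big_nat1_eq; case: ifP => // _; exact: normsq_ge0.
Qed.

Lemma single_subproof n z : single n z \in @sqsummable_pred R.
Proof. by apply/asboolP; apply: sqsummable_le => m; exact: sum_normsq_single. Qed.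

Definition ell2_single n z : ell2 R := Ell2 (single_subproof n z).

Lemma norm_single n z : `|ell2_single n z| = (Num.sqrt (normsq z))%:C.
Proof.
rewrite ell2_normE; congr (Num.sqrt _)%:C; apply/le_anti.
rewrite norm2_le; last by move=> m; exact: sum_normsq_single.
have := normsq_le_norm2 n (ell2P (ell2_single n z)).
by rewrite /= {1}/single eqxx.
Qed.

Lemma rotation_single t n z :
  rotation t (ell2_single n z) - ell2_single n z =
  ell2_single n ((phase (t n) - 1) * z).
Proof.
apply/val_inj/funext => k.
rewrite /= -[LHS]/(phase (t k) * single n z k - single n z k) /single.
by case: eqP => [->|_]; ring.
Qed.

End Rotation.

(** * Homomorphisms to the reals and property (T) *)

Section CharacterSum.
Variables (R : realType) (G : groupType) (lam : G -> R).
Hypothesis lamM : forall x y, lam (x * y)%g = lam x + lam y.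

(** The direct sum over [n] of the unitary characters
    [x |-> exp (i * lam x / n.+1)]: they converge pointwise to the trivial
    character as [n] grows. *)
Definition character_sum_fun (x : G) : {linear ell2 R -> ell2 R} :=
  rotation (fun n => lam x / n.+1%:R).

Lemma character_sum1 u : character_sum_fun 1%g u = u.
Proof.
have lam1 : lam 1%g = 0 by apply: (addrI (lam 1%g)); rewrite -lamM mulg1 addr0.
apply/val_inj/funext => k /=.
by rewrite lam1 mul0r phase0 mul1r.
Qed.

Lemma character_sumM x y u :
  character_sum_fun (x * y)%g u = character_sum_fun x (character_sum_fun y u).
Proof.
by apply/val_inj/funext => k /=; rewrite lamM mulrDl phaseD mulrA.
Qed.

Definition character_sum : unitary_rep G (ell2_hilbert R) :=
  @UnitaryRep R G (ell2_hilbert R) character_sum_fun character_sum1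
    character_sumM (fun x u v => rotation_inner _ u v).

(** On the [n]-th basis vector, [x] acts by a phase of angle [lam x / n.+1], which
    is uniformly small on a finite set once [n] is large. The vector is fixed by
    [H] because [lam] vanishes there. *)
Lemma character_sum_almost_invariant (H : groupClosed G) :
  (forall h, h \in H -> lam h = 0) ->
  almost_invariant_fixed_vectors H character_sum.
Proof.
move=> lamH Q e /finite_seqP[s ->] e0.
have e2 : 0 < e / 2 by rewrite divr_gt0.
have [d d0 phd] := @phase_near0 R ((e / 2) ^+ 2) (exprn_gt0 _ e2).
pose M := \sum_(x <- s) `|lam x|.
have M0 : 0 <= M by apply: sumr_ge0.
have lamM' x : x \in s -> `|lam x| <= M.
  by move=> xs; rewrite /M (big_rem x)//= lerDl sumr_ge0.
pose n := Num.bound (M / d).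
have nP : M / n.+1%:R < d.
  rewrite ltr_pdivrMr ?ltr0n// mulrC -ltr_pdivrMr//.
  apply: (@lt_trans _ _ n%:R); last by rewrite ltr_nat.
  by apply: archi_boundP; rewrite divr_ge0// ltW.
exists (ell2_single n 1 : ell2_hilbert R); split.
- move=> h Hh; apply/val_inj/funext => k /=.
  by rewrite lamH// mul0r phase0 mul1r.
- by rewrite norm_single /normsq /= expr1n expr0n addr0 sqrtr1.
- apply: (@le_lt_trans _ _ (e / 2)); last by rewrite gtr_pMr// invf_lt1 ?ltr1n.
  (* The supremum over an empty [Q] is 0 by convention. *)
  case: s @M M0 lamM' @n nP => [|x0 s] M M0 lamM' n nP.
    rewrite [X in sup X](_ : _ = set0) ?sup0 1?ltW//.
    by apply/seteqP; split => // y [x].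
  apply: ge_sup; first by eexists; exists x0 => //=; rewrite inE eqxx.
  move=> _ [x xs <-].
  rewrite [X in `|X|](rotation_single (fun n => lam x / n.+1%:R) n 1).
  rewrite norm_single mulr1 /=.
  have /ler_wsqrtr : normsq (phase (lam x / n.+1%:R) - 1) <= (e / 2) ^+ 2.
    rewrite ltW// phd// normrM [X in _ * X]ger0_norm ?invr_ge0//.
    by apply: le_lt_trans nP; rewrite ler_pM2r ?invr_gt0// lamM'.
  by rewrite sqrtr_sqr ger0_norm// ltW.
Qed.

(** If [lam x = 1], then [x] acts on the [k]-th coordinate by the angle
    [1 / k.+1], which lies strictly between 0 and [pi]; that phase is not 1. *)
Lemma character_sum_fixed (v : ell2 R) (x : G) : lam x = 1 ->
  character_sum x v = v -> v = 0.
Proof.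
move=> lamx xv; apply/val_inj/funext => k.
have /= := congr1 (fun u : ell2 R => u k) xv.
rewrite lamx mul1r => /eqP; rewrite -subr_eq0 -{2}[v k]mul1r -mulrBl mulf_eq0.
case/orP => [|/eqP//]; rewrite eq_complex /= => /andP[_].
have : 0 < sin (k.+1%:R^-1 : R).
  apply: sin_gt0_pi; rewrite invr_gt0 ltr0n /=.
  apply: (@le_lt_trans _ _ 1); first by rewrite invf_le1 ?ler1n ?ltr0n.
  by apply: lt_le_trans (pi_ge2 R); rewrite ltr1n.
by rewrite oppr0 addr0 => /gt_eqF ->.
Qed.

End CharacterSum.

(** Otherwise [lam] could be rescaled to take the value 1 at some [x0], and the sum
    of characters attached to it would have almost invariant [H]-fixed vectors
    but no vector fixed by [x0] except 0. *)
Lemma property_T_hom_real (R : realType) (G : groupType) (H : groupClosed G)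
    (lam : G -> R) :
  property_T R H -> (forall x y, lam (x * y)%g = lam x + lam y) ->
  (forall h, h \in H -> lam h = 0) -> forall x, lam x = 0.
Proof.
move=> T lamM lamH x0; apply: contrapT => /eqP lx0.
pose mu x := lam x / lam x0.
have muM x y : mu (x * y)%g = mu x + mu y by rewrite /mu lamM mulrDl.
have muH h : h \in H -> mu h = 0 by move=> /lamH; rewrite /mu => ->; rewrite mul0r.
have [v /eqP v0 vfix] := T _ _ (@character_sum_almost_invariant _ _ _ muM _ muH).
apply: v0; apply: (@character_sum_fixed _ _ _ muM v x0); first by rewrite /mu divff.
exact: vfix.
Qed.

Theorem proposition5p5 (R : realType) (G : groupType) (H : groupClosed G) :
  hecke_pair H -> property_T R H -> relatively_unimodular H.
Proof.
move=> hp T x.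
(* The logarithm of the relative modular function, as [R(y) = L(y^-1)]. *)
pose lam y : R := ln (hecke_L H y)%:R - ln (hecke_L H y^-1%g)%:R.
have pos y : ((hecke_L H y)%:R : R) \is Num.pos.
  by rewrite posrE ltr0n hecke_L_gt0.
have lamM y z : lam (y * z)%g = lam y + lam z.
  have := congr1 (fun n => ln (n%:R : R)) (hecke_L_cocycle hp y z).
  by rewrite !natrM !lnM ?rpredM// /lam; lra.
have lamH h : h \in H -> lam h = 0.
  by move=> Hh; rewrite /lam -hecke_L_mem// subrr.
have /eqP := property_T_hom_real T lamM lamH x.
rewrite subr_eq0 => /eqP /ln_inj => /(_ (pos _) (pos _)) /eqP.
rewrite eqr_nat /relative_modular hecke_R_LV// => /eqP <-.
by rewrite divff// pnatr_eq0 -lt0n hecke_L_gt0.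
Qed.
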